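(* Let $K$ be an algebraically closed field of characteristic $0$ and $A$ an $(n+1)$-dimensional $K$-vector space. The degree of $\operatorname{PO}(A)$ equals the degree of $\operatorname{SO}(A)$.
   Context: Here $n\ge1$. Fix coordinates $x_0,\dots,x_n$ on $A$. $\operatorname{O}(A)\subset\operatorname{GL}(A)$ is the orthogonal group of the quadratic form $x_0^2+\cdots+x_n^2$, $\operatorname{SO}(A)\subset\operatorname{O}(A)$ is the subgroup of elements of determinant $1$, and $\operatorname{PO}(A)$ is the image of $\operatorname{O}(A)$ in $\mathbb{P}\operatorname{GL}(A)$. The degree of a subgroup of $\mathbb{P}\operatorname{GL}(A)$ is the degree of its closure in $\mathbb{P}\operatorname{End}(A)$ (under the natural embedding $\mathbb{P}\operatorname{GL}(A)\subset\mathbb{P}\operatorname{End}(A)$). The degree of a subgroup of $\operatorname{GL}(A)$ is the degree of its closure in $\mathbb{P}(\operatorname{End}(A)\oplus K)$ (under $\operatorname{GL}(A)\subset\operatorname{End}(A)\subset\mathbb{P}(\operatorname{End}(A)\oplus K)$). *)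

(* Defs.v *)
From HB Require Import structures.
From mathcomp Require Import all_boot all_order all_algebra.
From mathcomp Require Export mpoly.

Set Implicit Arguments.
Unset Strict Implicit.
Unset Printing Implicit Defensive.

Import GRing.Theory.
Local Open Scope ring_scope.

Section ProjectiveGeometry.
Variables (K : fieldType) (V : vectType K).

(* The projective space P(V): its points are the lines through 0 in V. *)
Definition proj_space := {L : {vspace V} | \dim L == 1%N}.

Definition proj_set := proj_space -> Prop.

(* The homogeneous coordinates on P(V) are those of V in the basis
   vbasis fullv; another basis changes polynomials by a linear substitution,
   which affects none of the notions below. *)
Definition coord_poly := {mpoly K[\dim (fullv : {vspace V})]}.

Definition peval (p : coord_poly) (v : V) : K :=
  p.@[fun i => coord (vbasis fullv) i v].

Definition vanishes_on (p : coord_poly)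
    (X : proj_set) : Prop :=
  forall L : proj_space, X L -> forall v : V, v \in val L -> peval p v = 0.

Definition zariski_closure (X : proj_set) : proj_set := fun L =>
  forall (m : nat) (p : coord_poly), p \is m.-homog ->
    vanishes_on p X -> vanishes_on p (fun L' => L' = L).

(* b induces a basis of the degree m part of the homogeneous coordinate ring
   of X, that is, of the m-homogeneous polynomials modulo those vanishing
   on X. *)
Definition coord_ring_basis (X : proj_set) (m h : nat)
    (b : 'I_h -> coord_poly) : Prop :=
  (forall i, b i \is m.-homog) /\
  (forall p : coord_poly, p \is m.-homog ->
     exists! c : 'rV[K]_h, vanishes_on (p - \sum_(i < h) c 0 i *: b i) X).

(* h is the value at m of the Hilbert function of X. *)
Definition is_hilbert_value (X : proj_set) (m h : nat) : Prop :=
  exists b : 'I_h -> coord_poly, coord_ring_basis X m b.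

Definition is_hilbert_poly (X : proj_set) (P : {poly rat}) : Prop :=
  exists m0 : nat, forall m : nat, (m0 <= m)%N ->
    exists2 h : nat, is_hilbert_value X m h & P.[m%:R] = h%:R.

(* The degree of a closed subset X of P(V), all of whose top-dimensional
   components count: (dim X)! times the leading coefficient of the Hilbert
   polynomial of X, whose degree (size P).-1 is dim X. *)
Definition has_degree (X : proj_set) (d : nat) : Prop :=
  exists2 P : {poly rat}, is_hilbert_poly X P &
    d%:R = (size P).-1`!%:R * lead_coef P.

End ProjectiveGeometry.

Section OrthogonalGroups.
Variables (K : fieldType) (A : vectType K) (n : nat).
(* The coordinates x_0, ..., x_n on A are those with respect to e. *)
Variable e : n.+1.-tuple A.

Definition quad_form (v : A) : K := \sum_(i < n.+1) coord e i v ^+ 2.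

Definition GL_group (g : 'End(A)) : Prop := lker g == 0%VS.

Definition O_group (g : 'End(A)) : Prop :=
  GL_group g /\ forall v, quad_form (g v) = quad_form v.

Definition SO_group (g : 'End(A)) : Prop :=
  O_group g /\ \det (\matrix_(i, j) coord e i (g e`_j)) = 1.

(* The image of a subset of GL(A) under GL(A) -> PGL(A), with PGL(A) embedded
   in P(End(A)): the class of g is the line spanned by g. *)
Definition PGL_image (G : 'End(A) -> Prop) : proj_set 'End(A) :=
  fun L => exists2 g, G g & val L = <[g]>%VS.

Definition PO_group : proj_set 'End(A) := PGL_image O_group.

(* The image of a subset of GL(A) under
   GL(A) < End(A) < P(End(A) + K), g |-> [g : 1]. *)
Definition affine_image (G : 'End(A) -> Prop) :
    proj_set ('End(A) * K^o)%type :=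
  fun L => exists2 g, G g & val L = <[(g, 1 : K^o)]>%VS.

Definition has_degree_PGL (G : proj_set 'End(A)) (d : nat) : Prop :=
  has_degree (zariski_closure G) d.

Definition has_degree_GL (G : 'End(A) -> Prop) (d : nat) : Prop :=
  has_degree (zariski_closure (affine_image G)) d.

End OrthogonalGroups.

(* Main.v *)
(* Write N = n + 1, h(m) for the dimension of the space of forms of degree m on
   End(A) restricted to O(A), and s(m) for the dimension of the space of
   polynomial functions of degree at most m restricted to SO(A); these are the
   Hilbert functions of PO(A) and SO(A). The form q(g) = |g e_0|^2 of degree 2 is
   1 on O(A), so multiplication by q raises degrees by 2 without changing the
   functions; as -1 is in O(A), forms of degrees m and m + 1 are independent on
   O(A), and they span the polynomial functions of degree at most m + 1. Since
   (1 + det) / 2 and (1 - det) / 2 have degree N and are the indicator functions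
   of the two components of O(A), which a reflection exchanges,
     h(m) + h(m + 1) <= 2 s(m + 1) <= h(m + N) + h(m + N + 1).
   Hence the Hilbert polynomials have the same degree and leading coefficient.

   Hilbert polynomials exist because the standard monomials (those which are not
   leading monomials of forms vanishing on X) form a basis of the coordinate ring
   of X; their exponents are a down-closed set, and the number of its elements of
   degree m is eventually polynomial in m, by slicing and Dickson's lemma. *)

From HB Require Import structures.
Require Import Defs.
From mathcomp Require Import all_boot all_order all_algebra.
From mathcomp Require Import perm ring lra zify.
From Stdlib Require Import ClassicalEpsilon.

Set Implicit Arguments.
Unset Strict Implicit.
Unset Printing Implicit Defensive.

Import Order.TTheory GRing.Theory Num.Theory.
Local Open Scope ring_scope.

(** * Polynomials with rational coefficients *)

Lemma horner_shift (P : {poly rat}) (c x : rat) :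
  (P \Po ('X + c%:P)).[x] = P.[x + c].
Proof. by rewrite horner_comp !hornerE. Qed.

Lemma size_sub_lead (R : nzRingType) (p q : {poly R}) s :
  (size p <= s.+1)%N -> (size q <= s.+1)%N -> p`_s = q`_s ->
  (size (p - q)%R <= s)%N.
Proof.
move=> /leq_sizeP hp /leq_sizeP hq e; apply/leq_sizeP => j.
rewrite leq_eqVlt => /predU1P [<-|lt]; rewrite coefB ?e ?subrr //.
by rewrite hp // hq // subrr.
Qed.

Lemma size_shift (P : {poly rat}) c : size (P \Po ('X + c%:P)) = size P.
Proof. by rewrite size_comp_poly2 // size_XaddC. Qed.

Lemma lead_coef_shift (P : {poly rat}) c :
  lead_coef (P \Po ('X + c%:P)) = lead_coef P.
Proof. by rewrite lead_coef_comp ?size_XaddC // lead_coefXaddC expr1n mulr1. Qed.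

Lemma size_shift_sub (P : {poly rat}) c :
  (size (P \Po ('X + c%:P) - P)%R <= (size P).-1)%N.
Proof.
have [->|P0] := eqVneq P 0; first by rewrite comp_poly0 subr0 size_poly0.
have sP : (size P).-1.+1 = size P by rewrite prednK // size_poly_gt0.
apply: size_sub_lead; rewrite ?size_shift ?sP //.
by have := lead_coef_shift P c; rewrite /lead_coef size_shift.
Qed.

Lemma coef_shift1_subXn d :
  (('X^(d.+1) : {poly rat}) \Po ('X + 1%:P) - 'X^(d.+1))`_d = d.+1%:R.
Proof.
rewrite comp_Xn_poly [X in X ^+ _]addrC exprDn big_ord_recr /=.
rewrite subnn expr0 mul1r binn mulr1n.
rewrite addrK coef_sum big_ord_recr /= big1 ?add0r => [|i _].
  by rewrite subSnn expr1 mul1r binSn coefMn coefXn eqxx.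
rewrite coefMn -polyC_exp coefCM coefXn gtn_eqF ?mulr0 ?mul0rn //.
Qed.

Lemma coef_shift1_sub (P : {poly rat}) d : (size P <= d.+2)%N ->
  (P \Po ('X + 1%:P) - P)`_d = P`_d.+1 * d.+1%:R.
Proof.
move=> sP; pose r := P - P`_d.+1 *: 'X^(d.+1).
have sr : (size r <= d.+1)%N.
  apply: size_sub_lead => //; last by rewrite coefZ coefXn eqxx mulr1.
  by apply: leq_trans (size_scale_leq _ _) _; rewrite size_polyXn.
have eP : P = P`_d.+1 *: 'X^(d.+1) + r by rewrite addrC subrK.
rewrite {1 2}eP comp_polyD comp_polyZ opprD addrACA -scalerBr coefD coefZ.
rewrite coef_shift1_subXn [X in _ + X]nth_default ?addr0 //.
apply: leq_trans (size_shift_sub _ _) _.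
by case: (size r) sr.
Qed.

(** Induction on the size: the difference of [Q0] has the same top coefficient as [P], so what
    remains to be summed is smaller. *)
Lemma poly_antidifference (P : {poly rat}) :
  exists Q : {poly rat}, forall x, Q.[x + 1] - Q.[x] = P.[x].
Proof.
have [s] := ubnP (size P); elim: s P => // s IH P; rewrite ltnS => sP.
case: s => [|d] in IH sP *.
  exists 0 => x; move: sP; rewrite leqn0 size_poly_eq0 => /eqP ->.
  by rewrite !horner0 subrr.
pose Q0 : {poly rat} := (P`_d / d.+1%:R) *: 'X^(d.+1).
have sQ0 : (size Q0 <= d.+2)%N.
  by apply: leq_trans (size_scale_leq _ _) _; rewrite size_polyXn.
have [|Q hQ] := IH (P - (Q0 \Po ('X + 1%:P) - Q0)).
  rewrite ltnS; apply: size_sub_lead => //.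
    by apply: leq_trans (size_shift_sub _ _) _; case: (size Q0) sQ0.
  by rewrite coef_shift1_sub // coefZ coefXn eqxx mulr1 divfK // pnatr_eq0.
exists (Q + Q0) => x.
have := hQ x; rewrite !(hornerD, hornerN) horner_shift; lra.
Qed.

(** Taking the first difference lowers the degree by one and multiplies the leading coefficient by
    the old degree, so the factorial times the leading coefficient stays the same down to
    constants. *)
Lemma integer_valued_lead_coef (P : {poly rat}) m0 :
  (forall m, (m0 <= m)%N -> exists z : int, P.[m%:R] = z%:~R) ->
  exists z : int, (size P).-1`!%:R * lead_coef P = z%:~R.
Proof.
move sP : (size P) => s; elim: s P sP => [|[|d] IH] P sP hP.
- by exists 0; rewrite /lead_coef sP nth_default ?mulr0 ?sP.
- have [z hz] := hP m0 (leqnn _); exists z.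
  move/eqP: sP; rewrite mul1r -hz => /size_poly1P [c _ ->].
  by rewrite lead_coefC hornerC.
have lP : lead_coef P = P`_d.+1 by rewrite /lead_coef sP.
have P0 : P`_d.+1 != 0 by rewrite -lP lead_coef_eq0 -size_poly_eq0 sP.
pose D := P \Po ('X + 1%:P) - P.
have cD : D`_d = P`_d.+1 * d.+1%:R by rewrite coef_shift1_sub ?sP.
have sD : size D = d.+1.
  apply/eqP; rewrite eqn_leq; apply/andP; split.
    by apply: leq_trans (size_shift_sub _ _) _; rewrite sP.
  rewrite ltnNge; apply/negP => /leq_sizeP/(_ d (leqnn _))/eqP.
  by rewrite cD mulf_eq0 (negbTE P0) pnatr_eq0.
have [|z hz] := IH D sD.
  move=> m hm; have [z1 h1] := hP m hm.
  have [|z2 h2] := hP m.+1; first exact: leqW.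
  exists (z2 - z1); rewrite hornerD hornerN horner_shift.
  by rewrite natr1 h2 h1 rmorphB.
exists z; rewrite -hz /lead_coef sP sD /= cD factS natrM; ring.
Qed.

Lemma ev_nonneg_lead_coef (P : {poly rat}) m0 :
  (forall m, (m0 <= m)%N -> 0 <= P.[m%:R]) -> 0 <= lead_coef P.
Proof.
move=> hP; rewrite leNgt; apply/negP => lP.
move sP : (size P) => s; case: s => [|[|d]] in sP.
- by rewrite /lead_coef sP nth_default ?ltxx ?sP in lP.
- have := hP m0 (leqnn _); rewrite horner_coef sP big_ord1 expr0 mulr1.
  by move: lP; rewrite /lead_coef sP ltNge => /negP.
pose C := \sum_(i < d.+1) `|P`_i|; pose l := - lead_coef P.
have l0 : 0 < l by rewrite oppr_gt0.
have C0 : 0 <= C by apply: sumr_ge0.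
(* Beyond [C / l] the top term outweighs all the others together; adding [m0] keeps [m] in the range
   of the hypothesis. *)
pose m := (Num.bound (C / l) + m0).+1.
have hm : C < l * m%:R.
  rewrite mulrC -ltr_pdivrMr //; apply: (lt_le_trans (archi_boundP _)).
    by rewrite divr_ge0 // ltW.
  by rewrite ler_nat /m -addnS leq_addr.
have /hP : (m0 <= m)%N by rewrite /m -addSn leq_addl.
apply/negP; rewrite -ltNge horner_coef sP big_ord_recr /=.
have m1 : 1 <= m%:R :> rat by rewrite ler1n.
have hs : \sum_(i < d.+1) P`_i * m%:R ^+ i <= C * m%:R ^+ d.
  rewrite mulr_suml; apply: ler_sum => i _.
  apply: le_trans (ler_norm _) _; rewrite normrM [`|_ ^+ _|]ger0_norm.
    by apply: ler_wpM2l => //; apply: ler_weXn2l => //; rewrite -ltnS.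
  by apply: exprn_ge0; lra.
have e : P`_d.+1 = - l by rewrite opprK /lead_coef sP.
have md : 0 < m%:R ^+ d :> rat by apply: exprn_gt0; lra.
rewrite e exprS; apply: (le_lt_trans (lerD hs (lexx _))).
rewrite mulrA -mulrDl; apply: (@le_lt_trans _ _ ((C + - l * m%:R) * m%:R ^+ d)) => //.
rewrite pmulr_llt0 //; lra.
Qed.

(** Eventually [R = Q - P] lies between 0 and the difference [D] of [P]. For nonzero [P] the degree
    of [D] is below that of [P]; comparing leading coefficients, so is the degree of [R]. *)
Lemma sandwich_lead_coef (P Q : {poly rat}) (c m0 : nat) :
  (forall m, (m0 <= m)%N -> P.[m%:R] <= Q.[m%:R] <= P.[(m + c)%:R]) ->
  size P = size Q /\ lead_coef P = lead_coef Q.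
Proof.
move=> h; pose R := Q - P; pose D := P \Po ('X + c%:R%:P) - P.
have R0 : 0 <= lead_coef R.
  apply: (@ev_nonneg_lead_coef _ m0) => m /h /andP [h1 _].
  by rewrite hornerD hornerN subr_ge0.
have DR0 : 0 <= lead_coef (D - R).
  apply: (@ev_nonneg_lead_coef _ m0) => m /h /andP [_].
  rewrite !(hornerD, hornerN) horner_shift natrD; lra.
have eQ : Q = P + R by rewrite addrC subrK.
have [P0|P0] := eqVneq P 0.
  move: DR0; rewrite /D P0 comp_poly0 subrr sub0r lead_coefN oppr_ge0 => DR0.
  have /eqP : lead_coef R = 0 by apply/eqP; rewrite eq_le R0 DR0.
  by rewrite lead_coef_eq0 => /eqP R00; rewrite eQ P0 R00 addr0.
have sP : (0 < size P)%N by rewrite size_poly_gt0.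
have sD : (size D < size P)%N.
  by have := size_shift_sub P c%:R; rewrite -/D; move: sP; case: (size P).
have sR : (size R < size P)%N.
  rewrite ltnNge; apply/negP => sPR.
  have sDR : (size D < size (- R))%N by rewrite size_polyN; apply: leq_trans sPR.
  move: DR0; rewrite addrC lead_coefDl // lead_coefN oppr_ge0 => DR0.
  have /eqP : lead_coef R = 0 by apply/eqP; rewrite eq_le R0 DR0.
  rewrite lead_coef_eq0 => /eqP R00.
  by move: sPR; rewrite R00 size_poly0 leqNgt sP.
by rewrite eQ size_polyDl // lead_coefDl.
Qed.

(** * Counting down-closed sets of exponents *)

Definition eventually_poly (f : nat -> nat) : Prop :=
  exists (P : {poly rat}) (m0 : nat),
    forall m, (m0 <= m)%N -> P.[m%:R] = (f m)%:R.

Lemma eventually_poly_eq f g m0 : (forall m, (m0 <= m)%N -> f m = g m) ->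
  eventually_poly f -> eventually_poly g.
Proof.
move=> e [P [m1 h]]; exists P, (maxn m0 m1) => m.
by rewrite geq_max => /andP [h0 h1]; rewrite h // e.
Qed.

Lemma eventually_poly_sum I (r : seq I) (f : I -> nat -> nat) :
  (forall i, eventually_poly (f i)) ->
  eventually_poly (fun m => \sum_(i <- r) f i m)%N.
Proof.
move=> hf; elim: r => [|i r [Q [m0 IH]]].
  by exists 0, 0%N => m _; rewrite big_nil horner0.
have [P [m1 hP]] := hf i; exists (P + Q), (maxn m0 m1) => m.
rewrite geq_max => /andP [h0 h1].
by rewrite big_cons natrD hornerD hP // IH.
Qed.

Lemma eventually_poly_sub f j :
  eventually_poly f -> eventually_poly (fun m => f (m - j)%N).
Proof.
move=> [P [m0 hP]]; exists (P \Po ('X + (- j%:R)%:P)), (m0 + j)%N => m hm.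
have jm : (j <= m)%N by apply: leq_trans hm; rewrite leq_addl.
by rewrite horner_shift -natrB // hP // leq_subRL // addnC.
Qed.

Lemma eventually_poly_partial_sum f : eventually_poly f ->
  eventually_poly (fun m => \sum_(i < m.+1) f i)%N.
Proof.
move=> [P [m0 hP]]; have [Q hQ] := poly_antidifference P.
pose S m := (\sum_(i < m.+1) f i)%N.
exists (Q \Po ('X + 1%:P) + ((S m0)%:R - Q.[m0%:R + 1])%:P), m0 => m hm.
rewrite hornerD hornerC horner_shift -(subnK hm).
elim: (m - m0)%N => [|k IH]; first by rewrite add0n; ring.
rewrite addSn big_ord_recr /= natrD -IH -hP ?leqW ?leq_addl //.
by rewrite -hQ -natr1; ring.
Qed.

(** The exponent vectors of the monomials of degree [m] in [k] variables, listed by first entry so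
    that counts can be sliced. *)
Fixpoint compositions (k m : nat) : seq (seq nat) :=
  if k is k'.+1 then
    [seq j :: s | j <- iota 0 m.+1, s <- compositions k' (m - j)]
  else if m == 0%N then [:: [::]] else [::].

Lemma compositionsS k m : compositions k.+1 m =
  [seq j :: s | j <- iota 0 m.+1, s <- compositions k (m - j)].
Proof. by []. Qed.

Lemma mem_compositions k m s :
  (s \in compositions k m) = (size s == k) && (sumn s == m).
Proof.
elim: k m s => [|k IH] m s; first by case: m s => [|m] [|a s].
rewrite compositionsS.
apply/allpairsPdep/andP => [[j [t [+ + ->]]]|].
  rewrite mem_iota IH => /= hj /andP [/eqP -> /eqP ->].
  by split=> //; apply/eqP; lia.
case: s => [|j t] [// /eqP [hs] /eqP hm]; exists j, t; split=> //.
  by rewrite mem_iota add0n ltnS -hm /= leq_addr.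
by rewrite IH hs eqxx -hm /= addKn eqxx.
Qed.

Lemma compositions_uniq k m : uniq (compositions k m).
Proof.
elim: k m => [|k IH] m; first by rewrite /=; case: (m == 0%N).
rewrite compositionsS; apply: allpairs_uniq_dep;
  [exact: iota_uniq | by move=> j _; exact: IH |].
by move=> [j s] [j' s'] _ _ /= [-> ->].
Qed.

Lemma count_compositionsS (D : pred (seq nat)) k m :
  count D (compositions k.+1 m) =
  (\sum_(j < m.+1)
     count (fun s => D (nat_of_ord j :: s)) (compositions k (m - j)))%N.
Proof.
rewrite compositionsS count_flatten sumnE !big_map.
rewrite (big_nth 0%N) size_iota big_mkord; apply: eq_bigr => j _.
by rewrite nth_iota // add0n count_map.
Qed.

(** * Down-closed sets of exponents and finite generation of their complements *)

Definition down_closed (k : nat) (D : pred (seq nat)) : Prop :=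
  forall s t, size s = k -> all2 leq t s -> D s -> D t.

(** For down-closed [D] this is finite generation of the monomial ideal whose exponents are those
    outside [D]. *)
Definition fin_gen_complement (k : nat) (D : pred (seq nat)) : Prop :=
  exists2 G : seq (seq nat), {in G, forall g, size g = k /\ ~~ D g} &
    forall s, size s = k -> ~~ D s -> exists2 g, g \in G & all2 leq g s.

(** The intersection of the descending chain is down-closed; each of the finitely many generators of
    its complement leaves the chain at some stage, and past the last of these stages the chain is
    constant. *)
Lemma down_closed_chain_stable k (D : nat -> pred (seq nat)) :
  (forall E, down_closed k E -> fin_gen_complement k E) ->
  (forall i, down_closed k (D i)) ->
  (forall i j s, (i <= j)%N -> size s = k -> D j s -> D i s) ->
  exists i0, forall i s, (i0 <= i)%N -> size s = k -> D i s = D i0 s.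
Proof.
move=> fin dD mono.
(* Membership in all [D i] is made boolean by excluded middle. *)
pose V s : bool :=
  if excluded_middle_informative (forall i, D i s) then true else false.
have VP s : reflect (forall i, D i s) (V s).
  by rewrite /V; case: excluded_middle_informative => h; constructor.
have [|G hG gG] := fin V.
  by move=> s t hs le /VP Vs; apply/VP => i; exact: dD (Vs i).
have [i0 hi0] : exists i0, {in G, forall g, ~~ D i0 g}.
  elim: G hG {gG} => [|g G IHG] hG; first by exists 0%N.
  have [|i1 h1] := IHG; first by move=> x xG; apply: hG; rewrite inE xG orbT.
  have [sg Vg] := hG g (mem_head _ _).
  have [i2 h2] : exists i, ~~ D i g.
    case: (classic (exists i, ~~ D i g)) => // nex; case/negP: Vg.
    by apply/VP => i; apply/negPn/negP => ?; apply: nex; exists i.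
  exists (maxn i1 i2) => x; rewrite inE => /predU1P [->|xG].
    by apply: contra h2; apply: mono => //; apply: leq_maxr.
  have [sx _] : size x = k /\ ~~ V x by apply: hG; rewrite inE xG orbT.
  by apply: contra (h1 x xG); apply: mono => //; apply: leq_maxl.
exists i0 => i s le hs; apply/idP/idP; first exact: mono.
apply: contraLR => nDi; have [|g gG' leg] := gG s hs.
  by apply: contra nDi => /VP.
by apply: contra (hi0 g gG'); apply: dD.
Qed.

Lemma slice_down_closed k D i :
  down_closed k.+1 D -> down_closed k (fun s => D (i :: s)).
Proof. by move=> dD s t hs le; apply: dD => /=; rewrite ?hs // leqnn. Qed.

Lemma slice_antitone k D i j s : down_closed k.+1 D -> (i <= j)%N ->
  size s = k -> D (j :: s) -> D (i :: s).
Proof.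
move=> dD ij hs; apply: dD => /=; rewrite ?hs // ij /=.
by elim: s {hs} => //= a s ->; rewrite leqnn.
Qed.

(* Dickson's lemma *)
Lemma down_closed_fin_gen_complement k D :
  down_closed k D -> fin_gen_complement k D.
Proof.
elim: k D => [|k IH] D dD.
  have [D0|D0] := boolP (D [::]).
    by exists [::] => // s /size0nil ->; rewrite D0.
  exists [:: [::]] => [g|s /size0nil ->]; first by rewrite inE => /eqP ->.
  by exists [::].
have dDi i := slice_down_closed (i := i) dD.
have [|i0 stab] := down_closed_chain_stable IH dDi.
  by move=> i j s; apply: slice_antitone.
have [G hG gG] := IH _ (dDi i0).
(* [F] collects generators for the slices below [i0]; from [i0] on all slices coincide, so [G]
   serves for them. *)
have [F hF gF] : exists2 F : seq (seq nat),
    {in F, forall g, size g = k.+1 /\ ~~ D g} &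
    forall i s, (i < i0)%N -> size s = k -> ~~ D (i :: s) ->
      exists2 g, g \in F & all2 leq g (i :: s).
  elim: (i0) => [|i1 [F hF gF]]; first by exists [::].
  have [G1 hG1 gG1] := IH _ (dDi i1).
  exists ([seq i1 :: g | g <- G1] ++ F).
    move=> g; rewrite mem_cat => /orP [/mapP [g' /hG1 [<- ?] ->] //|]; exact: hF.
  move=> i s; rewrite ltnS leq_eqVlt => /predU1P [->|lt] hs Ds.
    have [g gG1' le] := gG1 s hs Ds; exists (i1 :: g); last by rewrite /= leqnn.
    by rewrite mem_cat map_f.
  by have [g gF' le] := gF i s lt hs Ds; exists g; rewrite // mem_cat gF' orbT.
exists ([seq i0 :: g | g <- G] ++ F).
  move=> g; rewrite mem_cat => /orP [/mapP [g' /hG [<- ?] ->] //|]; exact: hF.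
case=> [|i s] // [hs] Ds; have [lt|le] := ltnP i i0.
  by have [g gF' le] := gF i s lt hs Ds; exists g; rewrite // mem_cat gF' orbT.
rewrite stab // in Ds; have [g gG' le'] := gG s hs Ds.
by exists (i0 :: g); rewrite /= ?le // mem_cat map_f.
Qed.

(** Slicing by the first entry: finitely many slices contribute shifted counts in one variable less,
    and the remaining slices, all equal, contribute a partial sum of one such count. *)
Theorem eventually_poly_count k (D : pred (seq nat)) : down_closed k D ->
  eventually_poly (fun m => count D (compositions k m)).
Proof.
elim: k D => [|k IH] D dD.
  by exists 0, 1%N => -[|m] //= _; rewrite horner0.
have dDi i := slice_down_closed (i := i) dD.
have [|j0 stab] :=
    down_closed_chain_stable (@down_closed_fin_gen_complement k) dDi.
  by move=> i j s; apply: slice_antitone.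
pose c j m := count (fun s => D (j :: s)) (compositions k m).
have ev j : eventually_poly (c j) by exact: IH.
(* The slices [j >= j0], indexed by the degree [i = m - j] left for the other entries. *)
pose tail m := (\sum_(i < (m - j0).+1) c j0 i)%N.
(* The sum over two booleans packs both contributions into one sum. *)
apply: (@eventually_poly_eq
  (fun m => \sum_(b <- [:: true; false])
     if b then \sum_(j <- iota 0 j0) c j (m - j) else tail m)%N _ j0).
  move=> m hm; rewrite count_compositionsS 2!big_cons big_nil addn0.
  rewrite -(big_mkord xpredT (fun j => c j (m - j)%N)).
  rewrite (big_cat_nat (n := j0)) //=; last exact: leqW.
  rewrite /index_iota subn0; congr addn.
  rewrite -{1}[j0]add0n big_addn big_mkord subSn // (reindex_inj rev_ord_inj).
  apply: eq_bigr => i _; rewrite /c /=.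
  have -> : (m - ((m - j0).+1 - i.+1 + j0) = i)%N by have := ltn_ord i; lia.
  apply: eq_in_count => s; rewrite mem_compositions => /andP [/eqP hs _].
  by apply/esym/stab; rewrite // leq_addl.
apply: eventually_poly_sum => -[].
  by apply: eventually_poly_sum => j; apply: eventually_poly_sub.
exact/(eventually_poly_sub (f := fun m => \sum_(i < m.+1) c j0 i)%N)/eventually_poly_partial_sum.
Qed.

(** * Hilbert functions *)

Lemma mpoly_sum_seq (R : nzRingType) k (L : seq 'X_{1..k}) (p : {mpoly R[k]}) :
  uniq L -> {subset msupp p <= L} -> p = \sum_(a <- L) p@_a *: 'X_[a].
Proof.
move=> uL sub; rewrite {1}[p]mpolyE [RHS](bigID (mem (msupp p)) predT) /=.
rewrite [X in _ + X]big1 ?addr0 => [|a].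
  rewrite -[RHS]big_filter; apply: perm_big; apply: uniq_perm => //.
    exact: filter_uniq.
  by move=> a; rewrite mem_filter; apply/idP/andP => [h|[]] //; split=> //; exact: sub.
by rewrite -mcoeff_eq0 => /eqP ->; rewrite scale0r.
Qed.

Lemma mlead_sub_lt (R : nzRingType) k (p q : {mpoly R[k]}) :
  mlead q = mlead p -> q@_(mlead q) = p@_(mlead p) -> p - q != 0 ->
  (mlead (p - q) < mlead p)%O.
Proof.
move=> lq cq nz; rewrite lt_neqAle; apply/andP; split.
  apply/eqP => e; move: (nz); rewrite -mleadc_eq0 e mcoeffB -cq lq subrr.
  by rewrite eqxx.
by apply: le_trans (mleadB_le _ _) _; rewrite lq joinxx.
Qed.

Section HilbertFunction.
Variables (K : fieldType) (V : vectType K).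
Implicit Types (X : proj_set V) (p q : coord_poly V).
Local Notation k := (\dim (fullv : {vspace V})).

Lemma pevalD p q v : peval (p + q) v = peval p v + peval q v.
Proof. exact: mevalD. Qed.

Lemma pevalZ c p v : peval (c *: p) v = c * peval p v.
Proof. exact: mevalZ. Qed.

Lemma pevalM p q v : peval (p * q) v = peval p v * peval q v.
Proof. exact: mevalM. Qed.

Lemma vanishes_on0 X : vanishes_on 0 X.
Proof. by move=> L _ v _; rewrite /peval meval0. Qed.

Lemma vanishes_onD X p q :
  vanishes_on p X -> vanishes_on q X -> vanishes_on (p + q) X.
Proof. by move=> hp hq L XL v vL; rewrite pevalD (hp L) // (hq L) // addr0. Qed.

Lemma vanishes_onZ X c p : vanishes_on p X -> vanishes_on (c *: p) X.
Proof. by move=> hp L XL v vL; rewrite pevalZ (hp L) // mulr0. Qed.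

Lemma vanishes_onB X p q :
  vanishes_on p X -> vanishes_on q X -> vanishes_on (p - q) X.
Proof. by move=> hp hq; rewrite -scaleN1r; apply/vanishes_onD/vanishes_onZ. Qed.

Lemma vanishes_onMr X p q : vanishes_on p X -> vanishes_on (p * q) X.
Proof. by move=> hp L XL v vL; rewrite pevalM (hp L) // mul0r. Qed.

(** * Initial ideal and standard monomials *)

Definition initial X (a : 'X_{1..k}) : Prop :=
  exists p, [/\ p != 0, p \is (mdeg a).-homog, vanishes_on p X & mlead p = a].

(** Decided by excluded middle, so that standard monomials can be filtered and counted. *)
Definition standard X (a : 'X_{1..k}) : bool :=
  if excluded_middle_informative (initial X a) then false else true.

Lemma standardPn X a : reflect (initial X a) (~~ standard X a).
Proof. by rewrite /standard; case: excluded_middle_informative => h; constructor. Qed.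

Definition monom (s : seq nat) : 'X_{1..k} := [multinom nth 0%N s i | i < k].

Lemma monomE s i : monom s i = nth 0%N s i.
Proof. exact: mnmE. Qed.

Lemma monom_inj : {in [pred s | size s == k] &, injective monom}.
Proof.
move=> s t; rewrite !inE => /eqP hs /eqP ht e.
apply: (@eq_from_nth _ 0%N); rewrite ?hs ?ht // => i ik.
by rewrite -(monomE s (Ordinal ik)) e monomE.
Qed.

Lemma mdeg_monom s : size s = k -> mdeg (monom s) = sumn s.
Proof.
move=> hs; rewrite mdegE sumnE (big_nth 0%N) hs big_mkord.
by apply: eq_bigr => i _; rewrite monomE.
Qed.

(** Multiplying a vanishing form by a monomial multiplies its leading monomial, so the initial
    exponents are closed upwards. *)
Lemma standard_down_closed X : down_closed k (fun s => standard X (monom s)).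
Proof.
move=> s t hs le; apply: contraLR => /standardPn [p [p0 hp vp lp]].
have le_ts : (monom t <= monom s)%MM.
  apply/mnm_lepP => i; rewrite !monomE.
  move: le; rewrite all2E => /andP [/eqP sz /allP].
  have it : (i < size t)%N by rewrite sz hs.
  move/(_ (nth (0, 0)%N (zip t s) i)); rewrite mem_nth ?size_zip ?sz ?minnn -?sz //.
  by rewrite nth_zip // => /(_ isT).
have X0 : 'X_[monom s - monom t] != 0 :> coord_poly V.
  by rewrite -msize_poly_eq0 msizeX.
apply/standardPn; exists (p * 'X_[monom s - monom t]); split.
- by rewrite mulf_neq0.
- have -> : mdeg (monom s) = (mdeg (monom t) + mdeg (monom s - monom t))%N.
    by rewrite -mdegD addmC submK.
  by apply: dhomogM; rewrite ?dhomogX.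
- exact: vanishes_onMr.
by rewrite mleadM // lp mleadXm addmC submK.
Qed.

(** The division algorithm, by induction on the leading monomial. *)
Lemma standard_reduction X m p : p \is m.-homog -> exists r,
  [/\ r \is m.-homog, {in msupp r, forall a, standard X a} &
      vanishes_on (p - r) X].
Proof.
elim/mleadrect: p => p IH hp.
have [->|p0] := eqVneq p 0.
  exists 0; split; first exact: dhomog0.
    by move=> a; rewrite msupp0.
  by rewrite subr0; exact: vanishes_on0.
have dl : mdeg (mlead p) = m by apply: (dhomog_mf hp); exact: mlead_supp.
have lp0 : p@_(mlead p) != 0 by rewrite mleadc_eq0.
(* Subtracting any form with the same leading term as [p] gives access to the induction
   hypothesis. *)
have IH' q : q \is m.-homog -> mlead q = mlead p -> q@_(mlead q) = p@_(mlead p) ->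
    exists r, [/\ r \is m.-homog, {in msupp r, forall a, standard X a} &
      vanishes_on (p - q - r) X].
  move=> hq lq cq; have [->|pq0] := eqVneq (p - q) 0.
    exists 0; split; first exact: dhomog0.
      by move=> a; rewrite msupp0.
    by rewrite subr0; exact: vanishes_on0.
  by apply: IH; [exact: mlead_sub_lt | exact: rpredB].
have [std|/standardPn [q [q0 hq vq lq]]] := boolP (standard X (mlead p)).
  (* A standard leading term goes into the remainder. *)
  have [||| r [hr sr vr]] := IH' (p@_(mlead p) *: 'X_[mlead p]).
  - by apply: dhomogZ; rewrite dhomogX; apply/eqP.
  - by rewrite mleadZ // mleadXm.
  - by rewrite mleadZ // mleadXm mcoeffZ mcoeffX eqxx mulr1.
  exists (p@_(mlead p) *: 'X_[mlead p] + r); split.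
  - by apply: dhomogD => //; apply: dhomogZ; rewrite dhomogX; apply/eqP.
  - move=> a /msuppD_le; rewrite mem_cat => /orP [/msuppZ_le|/sr //].
    by rewrite msuppX inE => /eqP ->.
  - by rewrite opprD addrA.
have lq0 : q@_(mlead q) != 0 by rewrite mleadc_eq0.
have c0 : p@_(mlead p) / q@_(mlead q) != 0 by rewrite mulf_neq0 ?invr_eq0.
(* An initial one is cancelled by a multiple of a vanishing form. *)
have [||| r [hr sr vr]] := IH' ((p@_(mlead p) / q@_(mlead q)) *: q).
- by apply: dhomogZ; rewrite -dl.
- by rewrite mleadZ.
- by rewrite mleadZ // mcoeffZ divfK.
exists r; split=> //.
rewrite -[p](subrK ((p@_(mlead p) / q@_(mlead q)) *: q)) addrAC.
by apply: vanishes_onD => //; apply: vanishes_onZ.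
Qed.

Definition standard_monomials X m : seq 'X_{1..k} :=
  [seq monom s | s <- compositions k m & standard X (monom s)].

Lemma mem_standard_monomials X m a :
  (a \in standard_monomials X m) = (mdeg a == m) && standard X a.
Proof.
apply/mapP/andP => [[s + ->]|[/eqP da sa]].
  rewrite mem_filter mem_compositions => /and3P [std /eqP hs /eqP <-].
  by rewrite mdeg_monom.
have ea : monom (multinom_val a) = a.
  by apply/mnmP => i; rewrite monomE -mnm_nth.
have sz : size (multinom_val a) = k by rewrite size_tuple.
exists (val (val a)); rewrite ?ea //.
by rewrite mem_filter ea sa mem_compositions sz eqxx -mdeg_monom // ea da eqxx.
Qed.

Lemma standard_monomials_uniq X m : uniq (standard_monomials X m).
Proof.
rewrite map_inj_in_uniq ?filter_uniq ?compositions_uniq // => s t.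
rewrite !mem_filter !mem_compositions => /and3P [_ hs _] /and3P [_ ht _].
exact: monom_inj.
Qed.

(** Reduction gives spanning. A nonzero combination vanishing on [X] would have a leading monomial
    both standard and initial, whence uniqueness. *)
Lemma standard_monomials_basis X m (L := standard_monomials X m) :
  coord_ring_basis X m (fun i : 'I_(size L) => 'X_[nth 0%MM L i]).
Proof.
have stdL (i : 'I_(size L)) : nth 0%MM L i \in L by rewrite mem_nth.
have hom (i : 'I_(size L)) : ('X_[nth 0%MM L i] : coord_poly V) \is m.-homog.
  by move: (stdL i); rewrite mem_standard_monomials dhomogX => /andP [].
split=> // p hp; have [r [hr sr vr]] := standard_reduction X hp.
have uL : uniq L := standard_monomials_uniq X m.
have coefE (c : 'I_(size L) -> K) (i : 'I_(size L)) :
    (\sum_(j < size L) c j *: 'X_[nth 0%MM L j])@_(nth 0%MM L i) = c i.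
  rewrite raddf_sum (bigD1 i) //= big1 ?addr0 => [|j ji].
    by rewrite mcoeffZ mcoeffX eqxx mulr1.
  by rewrite mcoeffZ mcoeffX nth_uniq // -[_ == _]/(j == i) (negbTE ji) mulr0.
have rE : \sum_(j < size L) r@_(nth 0%MM L j) *: 'X_[nth 0%MM L j] = r.
  rewrite [RHS](mpoly_sum_seq uL) => [|a ar].
    by rewrite [RHS](big_nth 0%MM) big_mkord.
  by rewrite mem_standard_monomials (dhomog_mf hr ar) eqxx sr.
exists (\row_j r@_(nth 0%MM L j)); split.
  by under eq_bigr do rewrite mxE; rewrite rE.
move=> c vc; pose d : 'I_(size L) -> K := fun j => r@_(nth 0%MM L j) - c 0 j.
pose q : coord_poly V := \sum_(j < size L) d j *: 'X_[nth 0%MM L j].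
have vq : vanishes_on q X.
  have -> : q = (p - \sum_(j < size L) c 0 j *: 'X_[nth 0%MM L j]) - (p - r).
    rewrite opprB addrC addrA subrK -rE -sumrB.
    by apply: eq_bigr => j _; rewrite -scalerBl.
  exact: vanishes_onB.
have q0 : q = 0.
  apply/eqP/negPn/negP => q0; have lq := mlead_supp q0.
  have hq : q \is m.-homog by apply: rpred_sum => j _; apply: dhomogZ.
  have lL : mlead q \in L.
    have := lq; rewrite mcoeff_msupp /q; apply: contraR => lL.
    rewrite raddf_sum big1 // => j _; rewrite /= mcoeffZ mcoeffX.
    case: eqP => [e|_]; last by rewrite mulr0.
    by case/negP: lL; rewrite -e.
  move: lL; rewrite mem_standard_monomials => /andP [/eqP dl]; apply/negP.
  by apply/standardPn; exists q; rewrite dl.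
apply/rowP => j; rewrite mxE; apply/eqP; rewrite -subr_eq0.
by rewrite -[_ - _]/(d j) -coefE -/q q0 mcoeff0.
Qed.
End HilbertFunction.

(** * Forms as functions *)

Section HomogeneousFunctions.
Variable K : fieldType.

Theorem hilbert_poly_exists (V : vectType K) (X : proj_set V) :
  exists (h : nat -> nat) (P : {poly rat}) (m0 : nat),
    (forall m, is_hilbert_value X m (h m)) /\
    forall m, (m0 <= m)%N -> P.[m%:R] = (h m)%:R.
Proof.
have [P [m0 hP]] := eventually_poly_count (@standard_down_closed _ _ X).
exists (fun m => size (standard_monomials X m)), P, m0; split=> m.
  by eexists; apply: standard_monomials_basis.
by move/hP ->; rewrite size_map size_filter.
Qed.

(** The closure properties needed to evaluate forms at functions of degree 1. They are used for
    forms, for the homogeneity identity and for polynomial functions on [O(A)]. *)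
Record graded_closed (W : Type) (Q : nat -> (W -> K) -> Prop) : Prop := {
  graded_ext : forall m f g, f =1 g -> Q m f -> Q m g;
  graded_const : forall c, Q 0%N (fun=> c);
  graded0 : forall m, Q m (fun=> 0);
  gradedD : forall m f g, Q m f -> Q m g -> Q m (fun w => f w + g w);
  gradedM : forall m1 m2 f g,
    Q m1 f -> Q m2 g -> Q (m1 + m2)%N (fun w => f w * g w) }.

Section GradedClosed.
Variables (W : Type) (Q : nat -> (W -> K) -> Prop) (hQ : graded_closed Q).

Lemma gradedZ m c f : Q m f -> Q m (fun w => c * f w).
Proof. exact/(gradedM hQ (m1 := 0))/(graded_const hQ). Qed.

Lemma graded_sum (I : eqType) (r : seq I) (F : I -> W -> K) m :
  {in r, forall i, Q m (F i)} -> Q m (fun w => \sum_(i <- r) F i w).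
Proof.
elim: r => [|i r IH] hF.
  by apply: (graded_ext hQ (f := fun=> 0)) (graded0 hQ m) => w; rewrite big_nil.
apply: (graded_ext hQ (f := fun w => F i w + \sum_(j <- r) F j w)).
  by move=> w; rewrite big_cons.
apply: (gradedD hQ); first exact/hF/mem_head.
by apply: IH => j jr; apply: hF; rewrite inE jr orbT.
Qed.

Lemma gradedX m e f : Q m f -> Q (e * m)%N (fun w => f w ^+ e).
Proof.
move=> hf; elim: e => [|e IH].
  exact: (graded_ext hQ (f := fun=> 1) _ (graded_const hQ 1)).
rewrite mulSn; apply: (graded_ext hQ (f := fun w => f w * f w ^+ e)).
  by move=> w; rewrite exprS.
exact: (gradedM hQ).
Qed.

Lemma graded_prod I (r : seq I) (F : I -> W -> K) (d : I -> nat) :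
  (forall i, Q (d i) (F i)) ->
  Q (\sum_(i <- r) d i)%N (fun w => \prod_(i <- r) F i w).
Proof.
move=> hF; elim: r => [|i r IH].
  rewrite big_nil; apply: (graded_ext hQ (f := fun=> 1)) (graded_const hQ 1) => w.
  by rewrite big_nil.
rewrite big_cons; apply: (graded_ext hQ (f := fun w => F i w * \prod_(j <- r) F j w)).
  by move=> w; rewrite big_cons.
exact: (gradedM hQ).
Qed.

End GradedClosed.

(** As functions, forms do not depend on coordinates, and linear substitution becomes
    composition. *)
Definition form (V : vectType K) (m : nat) (f : V -> K) : Prop :=
  exists2 p : coord_poly V, p \is m.-homog & f =1 peval p.

Lemma form_graded (V : vectType K) : graded_closed (@form V).
Proof.
split=> [m f g fg [p hp fp]|c|m|m f g [p hp fp] [q hq gq]|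
         m1 m2 f g [p hp fp] [q hq gq]].
- by exists p => // v; rewrite -fg fp.
- exists (c *: 1) => [|v]; first exact/dhomogZ/dhomog1.
  by rewrite /peval mevalZ meval1 mulr1.
- by exists 0 => [|v]; rewrite ?dhomog0 // /peval meval0.
- by exists (p + q) => [|v]; rewrite ?dhomogD // pevalD fp gq.
- by exists (p * q) => [|v]; rewrite ?dhomogM // pevalM fp gq.
Qed.

Lemma form_scalar (V : vectType K) (f : V -> K) : scalar f -> form 1 f.
Proof.
move=> lin_f; pose l : {scalar V} := HB.pack f (GRing.isLinear.Build _ _ _ _ f lin_f).
rewrite -[f]/(l : V -> K).
exists (\sum_(i < \dim (fullv : {vspace V})) l (vbasis fullv)`_i *: 'X_i) => [|v].
  by apply: rpred_sum => i _; apply: dhomogZ; rewrite dhomogX; apply/eqP/mdeg1.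
rewrite {1}(coord_vbasis (memvf v)) linear_sum /peval raddf_sum.
by apply: eq_bigr => i _; rewrite linearZ /= mevalZ mevalXU mulrC.
Qed.

(** Each monomial of the form becomes a product of [m] functions of degree 1. *)
Lemma form_subst (V : vectType K) (W : Type) (Q : nat -> (W -> K) -> Prop)
    (L : W -> V) m f : graded_closed Q ->
  (forall i, Q 1%N (fun w => coord (vbasis fullv) i (L w))) ->
  form m f -> Q m (fun w => f (L w)).
Proof.
move=> hQ hL [p hp fp].
pose F (a : 'X_{1..\dim (fullv : {vspace V})}) w :=
  p@_a * \prod_i (coord (vbasis fullv) i (L w)) ^+ a i.
apply: (graded_ext hQ (f := fun w => \sum_(a <- msupp p) F a w)).
  by move=> w; rewrite fp /peval mevalE.
apply: (graded_sum hQ) => a ap; apply: (gradedZ hQ).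
have <- : mdeg a = m := dhomog_mf hp ap.
rewrite mdegE; apply: (graded_prod hQ) => i.
by have := gradedX hQ (a i) (hL i); rewrite muln1.
Qed.

Lemma form_linear (V W : vectType K) (L : W -> V) m f :
  linear L -> form m f -> form m (fun w => f (L w)).
Proof.
move=> lin_L; apply: form_subst; first exact: form_graded.
by move=> i; apply: form_scalar => a u v; rewrite lin_L linearP.
Qed.

(** The functions satisfying this identity are themselves a graded family with the coordinates in
    degree 1, so substitution of the identity map applies. *)
Lemma formZ_arg (V : vectType K) m (f : V -> K) :
  form m f -> forall a v, f (a *: v) = a ^+ m * f v.
Proof.
apply: (form_subst (L := id)
  (Q := fun m f => forall a v, f (a *: v) = a ^+ m * f v)); last first.
  by move=> i a v; rewrite linearZ expr1.
split=> [{}m {}f g fg hf a v|c a v|{}m a v|{}m {}f g hf hg a v|m1 m2 {}f g hf hg a v].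
- by rewrite -!fg.
- by rewrite expr0 mul1r.
- by rewrite mulr0.
- by rewrite hf hg mulrDr.
- by rewrite hf hg exprD mulrACA.
Qed.

(** * Linear independence and spanning on a set of points *)

Definition free_on (T : Type) (S : T -> Prop) (I : finType) (b : I -> T -> K) :=
  forall c : I -> K, (forall v, S v -> \sum_i c i * b i v = 0) -> forall i, c i = 0.

Definition spanned_on (T : Type) (S : T -> Prop) (I : finType) (b : I -> T -> K)
    (f : T -> K) :=
  exists c : I -> K, forall v, S v -> f v = \sum_i c i * b i v.

(** A vector in the left kernel of the coefficient matrix is a relation among the [b i] on [S];
    hence the rows are independent and no more numerous than the columns. *)
Lemma free_on_card_le (T : Type) (S : T -> Prop) (I J : finType)
    (b : I -> T -> K) (g : J -> T -> K) :
  free_on S b -> (forall i, spanned_on S g (b i)) -> (#|I| <= #|J|)%N.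
Proof.
move=> fb /fin_all_exists [C hC].
pose M : 'M[K]_(#|I|, #|J|) := \matrix_(i, j) C (enum_val i) (enum_val j).
have : row_free M.
  rewrite -kermx_eq0; apply/eqP/row_matrixP => r; rewrite row0.
  have hr : row r (kermx M) *m M = 0 by apply/sub_kermxP/row_sub.
  set u := row r _ in hr *; apply/rowP => k; rewrite [RHS]mxE.
  rewrite -(enum_valK k); apply: (fb (fun i => u 0 (enum_rank i))) => v Sv.
  under eq_bigr do rewrite hC // mulr_sumr.
  rewrite exchange_big big1 //= => j _.
  have := congr1 (fun N : 'rV_#|J| => N 0 (enum_rank j)) hr.
  rewrite mxE [RHS]mxE => e.
  apply: etrans (etrans (congr1 ( *%R^~ (g j v)) e) (mul0r _)).
  rewrite /= mulr_suml.
  rewrite (reindex (@enum_val _ I)) /=; last exact/onW_bij/enum_val_bij.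
  by apply: eq_bigr => i _; rewrite [M _ _]mxE enum_valK enum_rankK mulrA.
by move/eqP <-; exact: rank_leq_col.
Qed.

Definition join_fam (T : Type) r s (b1 : 'I_r -> T -> K) (b2 : 'I_s -> T -> K)
  (i : 'I_r + 'I_s) : T -> K :=
  match i with inl j => b1 j | inr j => b2 j end.

Lemma join_fam_sum T r s (b1 : 'I_r -> T -> K) (b2 : 'I_s -> T -> K) c v :
  \sum_i c i * join_fam b1 b2 i v =
  \sum_i c (inl i) * b1 i v + \sum_i c (inr i) * b2 i v.
Proof. by rewrite big_sumType. Qed.

Section HilbertBasis.
Variables (V : vectType K) (S : V -> Prop) (X : proj_set V).
Hypothesis S_neq0 : forall v, S v -> v != 0.
Hypothesis XE : forall L, X L <-> exists2 v, S v & val L = <[v]>%VS.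

(** A form vanishing on [X] vanishes on its closure by definition, and homogeneity reduces a line to
    a vector spanning it. *)
Lemma vanishes_onP m (p : coord_poly V) : p \is m.-homog ->
  vanishes_on p (zariski_closure X) <-> forall v, S v -> peval p v = 0.
Proof.
move=> hp; split=> [van v Sv|van].
  have dv : \dim <[v]>%VS == 1%N by rewrite dim_vline S_neq0.
  apply: (van (exist _ <[v]>%VS dv)); last exact: memv_line.
  by move=> m' q _ vq _ -> w; apply: vq; apply/XE; exists v.
have vanX : vanishes_on p X.
  move=> L /XE [v Sv ->] w /vlineP [a ->].
  by rewrite (@formZ_arg _ m) ?van ?mulr0 //; exists p.
by move=> L cL; exact: (cL m p hp vanX L erefl).
Qed.

Lemma hilbert_value_basis m h : is_hilbert_value (zariski_closure X) m h ->
  exists b : 'I_h -> V -> K, [/\ forall i, form m (b i), free_on S b &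
    forall f, form m f -> spanned_on S b f].
Proof.
move=> [b [hb bb]]; exists (fun i => peval (b i)).
have pevalB_sum p (c : 'I_h -> K) v :
    peval (p - \sum_i c i *: b i) v = peval p v - \sum_i c i * peval (b i) v.
  rewrite -scaleN1r pevalD pevalZ mulN1r; congr (_ - _).
  by rewrite /peval raddf_sum; apply: eq_bigr => i _; exact: mevalZ.
have homB p (c : 'I_h -> K) : p \is m.-homog -> p - \sum_i c i *: b i \is m.-homog.
  by move=> hp; apply: rpredB => //; apply: rpred_sum => i _; apply: dhomogZ.
split=> [i|c hc i|f [p hp fp]].
- by exists (b i).
- have h0 : (0 : coord_poly V) \is m.-homog by exact: dhomog0.
  have [x [_ ux]] := bb 0 h0.
  (* Every relation on [S] is an expansion of 0, and that expansion is unique. *)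
  have u (d : 'I_h -> K) : (forall v, S v -> \sum_i d i * peval (b i) v = 0) ->
      forall i, x 0 i = d i.
    move=> hd j; rewrite (ux (\row_j d j)) ?mxE //.
    under eq_bigr do rewrite mxE.
    apply/(vanishes_onP (homB 0 d h0)) => v Sv.
    by rewrite pevalB_sum hd // subr0 /peval meval0.
  rewrite -(u c hc) (u (fun=> 0)) // => v _.
  by rewrite big1 // => j _; rewrite mul0r.
have [c [vc _]] := bb p hp; exists (fun i => c 0 i) => v Sv.
move/(vanishes_onP (homB _ _ hp))/(_ v Sv)/eqP: vc.
by rewrite pevalB_sum subr_eq0 fp => /eqP.
Qed.

End HilbertBasis.
End HomogeneousFunctions.

(** * The orthogonal group *)

Section OrthogonalMatrices.
Variables (K : fieldType) (A : vectType K) (n : nat) (e : n.+1.-tuple A).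
Hypothesis e_basis : basis_of fullv e.
Hypothesis two_neq0 : 2%:R != 0 :> K.
Implicit Types (g h : 'End(A)) (u v : A).

Definition mat_of g : 'M[K]_n.+1 := \matrix_(i, j) coord e i (g e`_j).

Lemma coord_sum v : v = \sum_i coord e i v *: e`_i.
Proof. exact: (coord_basis e_basis (memvf v)). Qed.

Lemma coord_tuple (i j : 'I_n.+1) : coord e i e`_j = (i == j)%:R.
Proof. by rewrite coord_free ?(basis_free e_basis) // eq_sym. Qed.

Lemma coord_inj u v : (forall i, coord e i u = coord e i v) -> u = v.
Proof.
by move=> h; rewrite (coord_sum u) (coord_sum v); apply: eq_bigr => i _; rewrite h.
Qed.

Lemma mat_of_comp g h : mat_of (g \o h)%VF = mat_of g *m mat_of h.
Proof.
apply/matrixP => i j; rewrite !mxE comp_lfunE /= {1}(coord_sum (h e`_j)).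
rewrite !linear_sum; apply: eq_bigr => k _.
by rewrite !linearZ !mxE mulrC.
Qed.

Lemma quad_formD u v : quad_form e (u + v) =
  quad_form e u + quad_form e v + 2%:R * \sum_i coord e i u * coord e i v.
Proof.
rewrite /quad_form mulr_sumr -!big_split; apply: eq_bigr => i _ /=.
by rewrite linearD; ring.
Qed.

(** Polarization: as 2 is nonzero, invariance of the quadratic form at sums of basis vectors gives
    invariance of the bilinear form. *)
Lemma O_group_mat g : O_group e g -> (mat_of g)^T *m mat_of g = 1%:M.
Proof.
move=> [_ hg]; apply/matrixP => i j.
have := hg (e`_i + e`_j); rewrite linearD !quad_formD !hg.
move/addrI/(mulfI two_neq0) => eB; rewrite !mxE.
under eq_bigr do rewrite !mxE.
rewrite eB (bigD1 i) //= !coord_tuple eqxx mul1r big1 ?addr0 // => k ki.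
by rewrite coord_tuple (negbTE ki) mul0r.
Qed.

Lemma O_group_det g : O_group e g -> \det (mat_of g) = 1 \/ \det (mat_of g) = -1.
Proof.
move/O_group_mat/(congr1 determinant); rewrite det_mulmx det_tr det1 -expr2.
by move/eqP; rewrite sqrf_eq1 => /orP [] /eqP ->; [left|right].
Qed.

(** The orthogonal reflection in the hyperplane [x_0 = 0]. *)
Definition reflect_fun v : A := v - (2%:R * coord e ord0 v) *: e`_0.

Fact reflect_fun_linear : linear reflect_fun.
Proof.
move=> a u v; rewrite /reflect_fun linearP mulrDr scalerDl mulrCA.
by rewrite -[(a * _) *: _]scalerA scalerBr opprD addrACA.
Qed.

HB.instance Definition _ :=
  GRing.isLinear.Build K A A *:%R reflect_fun reflect_fun_linear.

Definition reflection : 'End(A) := linfun reflect_fun.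

Lemma coord_reflection i v :
  coord e i (reflection v) = (-1) ^+ (i == ord0) * coord e i v.
Proof.
rewrite lfunE /= /reflect_fun linearB linearZ /= -[e`_0]/(e`_(ord0 : 'I_n.+1)).
rewrite coord_tuple; case: eqP => [->|_] /=; [ring | by rewrite mulr0 subr0 mul1r].
Qed.

Lemma reflectionK v : reflection (reflection v) = v.
Proof.
apply: coord_inj => i; rewrite !coord_reflection mulrA -exprD addnn.
by rewrite -signr_odd odd_double mul1r.
Qed.

Lemma det_reflection : \det (mat_of reflection) = -1.
Proof.
have -> : mat_of reflection = diag_mx (\row_i (-1) ^+ (i == ord0)).
  apply/matrixP => i j; rewrite !mxE coord_reflection coord_tuple.
  by rewrite mulr_natr.
rewrite det_diag big_ord_recl mxE eqxx big1 ?mulr1 // => i _.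
by rewrite mxE.
Qed.

Lemma O_group_refl g : O_group e g -> O_group e (reflection \o g)%VF.
Proof.
move=> [ig hg]; split.
  apply/lker0P => u v; rewrite !comp_lfunE => /(congr1 reflection).
  by rewrite !reflectionK => /(lker0P ig).
move=> v; rewrite comp_lfunE -[RHS]hg; apply: eq_bigr => i _.
by rewrite coord_reflection exprMn -exprM mulnC exprM sqrrN !expr1n mul1r.
Qed.

Lemma reflection_compK g : (reflection \o (reflection \o g))%VF = g.
Proof. by apply/lfunP => v; rewrite !comp_lfunE reflectionK. Qed.

Lemma SO_group_refl g : O_group e g -> \det (mat_of g) = -1 ->
  SO_group e (reflection \o g)%VF.
Proof.
move=> Og dg; split; first exact: O_group_refl.
by rewrite -/(mat_of _) mat_of_comp det_mulmx det_reflection dg mulrNN mulr1.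
Qed.

Lemma det_refl_SO g : SO_group e g -> \det (mat_of (reflection \o g)%VF) = -1.
Proof.
by move=> [_ dg]; rewrite mat_of_comp det_mulmx det_reflection [X in _ * X]dg mulr1.
Qed.

Lemma O_group_opp g : O_group e g -> O_group e (- g).
Proof.
move=> [ig hg]; split.
  by apply/lker0P => u v; rewrite !opp_lfunE => /oppr_inj /(lker0P ig).
move=> v; rewrite opp_lfunE -[RHS]hg; apply: eq_bigr => i _.
by rewrite linearN sqrrN.
Qed.

Lemma O_group_neq0 g : O_group e g -> g != 0.
Proof.
move=> [/lker0P ig _]; apply/eqP => g0.
have e00 : e`_(ord0 : 'I_n.+1) = 0 by apply: ig; rewrite g0 !lfunE.
have := coord_tuple ord0 ord0; rewrite e00 linear0 eqxx => /esym/eqP.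
by rewrite oner_eq0.
Qed.

Lemma form_entry i v : form 1 (fun g => coord e i (g v)).
Proof.
by apply: form_scalar => a g h; rewrite add_lfunE scale_lfunE linearP.
Qed.

(** In the Leibniz formula each term is, up to sign, a product of [n + 1] linear forms. *)
Lemma form_det : form n.+1 (fun g => \det (mat_of g)).
Proof.
have hQ := form_graded 'End(A).
apply: (graded_sum hQ) => s _; apply: (gradedZ hQ).
have := graded_prod hQ (index_enum 'I_n.+1) (d := fun=> 1%N)
  (fun i => form_entry i e`_(s i)).
rewrite sum_nat_const card_ord muln1; apply: (graded_ext hQ) => g.
by apply: eq_bigr => i _; rewrite mxE.
Qed.

Lemma form_unit : exists2 q : 'End(A) -> K, form 2 q & forall g, O_group e g -> q g = 1.
Proof.
have hQ := form_graded 'End(A).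
exists (fun g => quad_form e (g e`_0)).
  apply: (graded_sum hQ) => i _.
  by have := gradedX hQ 2 (form_entry i e`_0).
move=> g [_ ->]; rewrite /quad_form (bigD1 ord0) //= -[e`_0]/(e`_(ord0 : 'I_n.+1)).
rewrite coord_tuple eqxx expr1n big1 ?addr0 // => i i0.
by rewrite coord_tuple (negbTE i0) expr0n.
Qed.

Lemma reflection_comp_linear : linear (fun g => (reflection \o g)%VF).
Proof. by move=> a g h; rewrite comp_lfunDr comp_lfunZr. Qed.

End OrthogonalMatrices.

(** * Comparison of the Hilbert functions *)

Section DegreeComparison.
Variables (K : fieldType) (A : vectType K) (n : nat) (e : n.+1.-tuple A).
Hypothesis e_basis : basis_of fullv e.
Hypothesis two_neq0 : 2%:R != 0 :> K.
Implicit Types (g h : 'End(A)).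
Local Notation W := ('End(A) * K^o)%type.
Local Notation det g := (\det (mat_of e g)).
Local Notation sigma := (reflection e).

(** Forms of degree [m - 1], with only the zero function in degree [-1]. *)
Definition form_pred m (f : 'End(A) -> K) : Prop :=
  if m is m'.+1 then form m' f else f =1 fun=> 0.

(* On [O(A)], [g |-> quad_form e (g e_0)] is a form of degree 2 equal to 1, so a
   polynomial function of degree at most [m] agrees there with the sum of a form
   of degree [m] and one of degree [m - 1]. *)
Definition affine_form m (f : 'End(A) -> K) : Prop :=
  exists f0 f1, [/\ form m f0, form_pred m f1 &
    forall g, O_group e g -> f g = f0 g + f1 g].

Lemma form_predM_form m1 m2 f1 f2 :
  form_pred m1 f1 -> form m2 f2 -> form_pred (m1 + m2) (fun g => f1 g * f2 g).
Proof.
have hQ := form_graded 'End(A); case: m1 => [f10 ff2|m1]; last exact: (gradedM hQ).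
case: m2 => [|m2] in ff2 *; first by move=> g; rewrite f10 mul0r.
by apply: (graded_ext hQ) (graded0 hQ m2) => g; rewrite f10 mul0r.
Qed.

(** The degrees add up as [2 + (m1 - 1) + (m2 - 1) = m1 + m2]. *)
Lemma form_predM m1 m2 q f1 f2 : form 2 q ->
  form_pred m1 f1 -> form_pred m2 f2 ->
  form (m1 + m2) (fun g => q g * (f1 g * f2 g)).
Proof.
have hQ := form_graded 'End(A); move=> hq.
case: m1 => [f10 _|m1 ff1].
  by apply: (graded_ext hQ) (graded0 hQ _) => g; rewrite f10 mul0r mulr0.
case: m2 => [f20|m2 ff2].
  by apply: (graded_ext hQ) (graded0 hQ _) => g; rewrite f20 !mulr0.
by have := gradedM hQ hq (gradedM hQ ff1 ff2); rewrite addSn addnS.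
Qed.

Lemma affine_form_graded : graded_closed affine_form.
Proof.
have hQ := form_graded 'End(A); have [q hq q1] := form_unit e_basis.
have p0 m : form_pred m (fun=> 0) by case: m => // m; exact: (graded0 hQ).
have pD m (f1 f2 : 'End(A) -> K) : form_pred m f1 -> form_pred m f2 ->
    form_pred m (fun v => f1 v + f2 v).
  case: m => [f10 f20 v|m]; first by rewrite f10 f20 addr0.
  exact: (gradedD hQ).
split=> [m f g fg [f0 [f1 [h0 h1 hf]]]|c|m|
    m f g [f0 [f1 [hf0 hf1 hf]]] [g0 [g1 [hg0 hg1 hg]]]|
    m1 m2 f g [f0 [f1 [hf0 hf1 hf]]] [g0 [g1 [hg0 hg1 hg]]]].
- by exists f0, f1; split=> // v /hf; rewrite fg.
- exists (fun=> c), (fun=> 0); split=> [||v _]; rewrite ?addr0 //.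
  exact: (graded_const hQ).
- exists (fun=> 0), (fun=> 0); split=> [||v _]; rewrite ?addr0 //.
  exact: (graded0 hQ).
- exists (fun v => f0 v + g0 v), (fun v => f1 v + g1 v); split.
  + exact: (gradedD hQ).
  + exact: pD.
  + by move=> v Ov; rewrite hf // hg // addrACA.
(* The product [(f0 + f1) * (g0 + g1)] is sorted by parity of degree; [q], equal to 1 on [O(A)],
   lifts [f1 * g1] to degree [m1 + m2]. *)
- exists (fun v => f0 v * g0 v + q v * (f1 v * g1 v)).
  exists (fun v => f1 v * g0 v + g1 v * f0 v); split.
  + by apply: (gradedD hQ); [exact: (gradedM hQ) | exact: form_predM].
  + by apply: pD; [|rewrite addnC]; exact: form_predM_form.
  + by move=> v Ov; rewrite hf // hg // q1 // mul1r; ring.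
Qed.

Lemma affine_form_leq m k f : affine_form m f -> affine_form (m + k) f.
Proof.
have hQ := form_graded 'End(A); have [q hq q1] := form_unit e_basis.
move=> hf; elim: k => [|k [f0 [f1 [h0 h1 hk]]]]; first by rewrite addn0.
(* The parts exchange roles: [q] lifts the lower one by 2, and the upper one becomes the lower. *)
rewrite addnS; exists (fun g => q g * f1 g), f0; split=> //.
  case: (m + k)%N h1 => [f10|l h1].
    by apply: (graded_ext hQ) (graded0 hQ _) => g; rewrite f10 mulr0.
  by have := gradedM hQ hq h1.
by move=> g Og; rewrite hk // q1 // mul1r addrC.
Qed.

Lemma form_affine_form m f : form m f -> affine_form m f.
Proof.
have hQ := form_graded 'End(A).
move=> hf; exists f, (fun=> 0); split=> // [|g _]; last by rewrite addr0.
by case: m {hf} => // m; exact: (graded0 hQ).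
Qed.

(** Each coordinate of [(g, 1)] is a linear form in [g] plus a constant, so it has degree at most 1
    on [O(A)]. *)
Lemma form_dehomogenize m (f : W -> K) :
  form m f -> affine_form m (fun g => f (g, 1 : K^o)).
Proof.
have hA := affine_form_graded.
apply: (form_subst (L := fun g => (g, 1 : K^o) : W) hA) => i.
pose l : {scalar W} := coord (vbasis fullv) i.
apply: (graded_ext hA (f := fun g => l (g, 0) + l (0, 1))).
  by move=> g; rewrite -linearD; congr (l (_, _)); rewrite /= ?addr0 ?add0r.
apply: (gradedD hA).
  apply/form_affine_form/form_scalar => a g h.
  by rewrite -linearP /=; congr (l (_, _)); rewrite /= addr0; apply/esym/mulr0.
exact/(affine_form_leq (m := 0) 1)/(graded_const hA).
Qed.

Definition SO_points (w : W) : Prop := exists2 g, SO_group e g & w = (g, 1 : K^o).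

(** On [O(A)], the indicator function of determinant 1 for [b = false] and of determinant -1 for
    [b = true]. *)
Definition half_det (b : bool) g : K := (1 + (-1) ^+ b * det g) / 2%:R.

Definition component_map (b : bool) g : 'End(A) :=
  if b then (sigma \o g)%VF else g.

(* If the [psi i] are functions on [SO(A)], these are their extensions by zero
   to [O(A)], together with the transports of the latter to the other
   component. *)
Definition two_copies s (psi : 'I_s -> W -> K) (i : bool * 'I_s) g : K :=
  half_det i.1 g * psi i.2 (component_map i.1 g, 1 : K^o).

Lemma half_det_SO b g : SO_group e g -> half_det b g = (~~ b)%:R.
Proof.
rewrite /half_det => -[_ /= dg]; rewrite [det g]dg mulr1.
by case: b; rewrite /= ?subrr ?mul0r // divff.
Qed.

Lemma half_det_refl b g : SO_group e g -> half_det b (sigma \o g)%VF = b%:R.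
Proof.
move=> Sg; rewrite /half_det det_refl_SO //.
by case: b; rewrite /= ?mulrNN ?mulr1 ?mul1r ?subrr ?mul0r // divff.
Qed.

Lemma O_groupP g : O_group e g ->
  SO_group e g \/ exists2 h, SO_group e h & g = (sigma \o h)%VF.
Proof.
move=> Og; case: (O_group_det e_basis two_neq0 Og) => dg; first by left.
right; exists (sigma \o g)%VF; first exact: SO_group_refl.
by rewrite reflection_compK.
Qed.

Lemma two_copies_sum s (psi : 'I_s -> W -> K) c g :
  \sum_i c i * two_copies psi i g =
  half_det false g * (\sum_i c (false, i) * psi i (g, 1 : K^o)) +
  half_det true g * (\sum_i c (true, i) * psi i ((sigma \o g)%VF, 1 : K^o)).
Proof.
transitivity (\sum_b \sum_i c (b, i) * two_copies psi (b, i) g).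
  by rewrite pair_bigA; apply: eq_bigr => -[].
rewrite big_bool addrC !mulr_sumr; congr (_ + _); apply: eq_bigr => i _.
  by rewrite mulrCA.
by rewrite mulrCA.
Qed.

(** Evaluating a relation at [g] in [SO(A)] isolates the coefficients of the first copy, at
    [sigma \o g] those of the second. *)
Lemma two_copies_free s (psi : 'I_s -> W -> K) :
  free_on SO_points psi -> free_on (O_group e) (two_copies psi).
Proof.
move=> fpsi c hc [b i]; move: i; apply: fpsi => _ [g Sg ->].
have Og : O_group e g by case: Sg.
have := hc _ Og; have := hc _ (O_group_refl e_basis Og).
rewrite !two_copies_sum reflection_compK // !(half_det_SO _ Sg) !(half_det_refl _ Sg) /=.
by rewrite !mul0r !mul1r add0r addr0; case: b.
Qed.

Lemma form_component_map m (f : W -> K) b : form m f ->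
  form m (fun w : W => f (component_map b w.1, w.2)).
Proof.
move=> hf; apply: (form_linear (L := fun w : W => (component_map b w.1, w.2))) hf.
move=> a [g x] [h y]; rewrite /component_map /=.
by case: b; rewrite ?reflection_comp_linear.
Qed.

(** On [SO(A)], expanding [f] gives the coefficients of the first copy, and expanding its composite
    with [sigma] those of the second. *)
Lemma two_copies_spanned m s (psi : 'I_s -> W -> K) (f : W -> K) :
  (forall f, form m f -> spanned_on SO_points psi f) -> form m f ->
  spanned_on (O_group e) (two_copies psi) (fun g => f (g, 1 : K^o)).
Proof.
move=> span hf; have [c hc] := span _ hf.
have [d hd] := span _ (form_component_map true hf).
exists (fun i => if i.1 then d i.2 else c i.2) => g; rewrite two_copies_sum /=.
case/O_groupP => [Sg|[h Sh ->]].
  by rewrite !(half_det_SO _ Sg) mul1r mul0r addr0; apply: hc; exists g.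
rewrite reflection_compK // !(half_det_refl _ Sh) mul0r mul1r add0r.
by rewrite -hd //; exists h.
Qed.

(** The indicator factor is affine in the determinant, which costs [n + 1] in the degree. *)
Lemma two_copies_affine_form m s (psi : 'I_s -> W -> K) i :
  (forall j, form m (psi j)) -> affine_form (n.+1 + m) (two_copies psi i).
Proof.
move=> hpsi; have hA := affine_form_graded; apply: (gradedM hA).
  apply: (graded_ext hA (f := fun g => 2%:R^-1 + (2%:R^-1 * (-1) ^+ i.1) * det g)).
    by move=> g; rewrite /half_det [RHS]mulrC mulrDr mulr1 mulrA.
  apply: (gradedD hA); first exact/(affine_form_leq (m := 0) n.+1)/(graded_const hA).
  exact/(gradedZ hA)/form_affine_form/form_det.
exact: (form_dehomogenize (form_component_map i.1 (hpsi i.2))).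
Qed.

(** * The two inequalities between the Hilbert functions *)

Section Bases.
Variables (m h0 h1 : nat).
Variables (b0 : 'I_h0 -> 'End(A) -> K) (b1 : 'I_h1 -> 'End(A) -> K).

(* Forms of degrees [m] and [m + 1] have opposite parities under [g |-> - g]. *)
Lemma join_fam_free :
  (forall i, form m (b0 i)) -> (forall i, form m.+1 (b1 i)) ->
  free_on (O_group e) b0 -> free_on (O_group e) b1 ->
  free_on (O_group e) (join_fam b0 b1).
Proof.
have hQ := form_graded 'End(A); move=> hb0 hb1 free0 free1 c hc.
pose f0 g := \sum_i c (inl i) * b0 i g; pose f1 g := \sum_i c (inr i) * b1 i g.
have ff0 : form m f0 by apply: (graded_sum hQ) => i _; apply: (gradedZ hQ).
have ff1 : form m.+1 f1 by apply: (graded_sum hQ) => i _; apply: (gradedZ hQ).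
have f01 g : O_group e g -> f0 g = 0 /\ f1 g = 0.
  (* At [- g] the relation reads [(-1)^m * (f0 g - f1 g) = 0]; with [f0 g + f1 g = 0] and 2 nonzero,
     both terms vanish. *)
  move=> Og; have := hc _ Og; have := hc _ (O_group_opp Og).
  rewrite !join_fam_sum -/(f0 _) -/(f1 _) -/(f0 _) -/(f1 _) -scaleN1r.
  rewrite (formZ_arg ff0) (formZ_arg ff1) exprS -mulrA mulN1r -mulrBr.
  move/eqP; rewrite mulf_eq0 signr_eq0 subr_eq0 /= => /eqP <- /eqP.
  by rewrite -mulr2n -mulr_natl mulf_eq0 (negbTE two_neq0) => /eqP ->.
case=> i; [apply: (free0 (fun i => c (inl i))) | apply: (free1 (fun i => c (inr i)))].
all: by move=> g /f01 [].
Qed.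

Lemma join_fam_spanned f :
  (forall f, form m f -> spanned_on (O_group e) b0 f) ->
  (forall f, form m.+1 f -> spanned_on (O_group e) b1 f) ->
  affine_form m.+1 f -> spanned_on (O_group e) (join_fam b0 b1) f.
Proof.
move=> span0 span1 [f1 [f0 [/span1 [c1 hc1] /span0 [c0 hc0] hf]]].
exists (fun i => match i with inl j => c0 j | inr j => c1 j end) => g Og.
by rewrite hf // hc1 // hc0 // join_fam_sum addrC.
Qed.

Variables (s : nat) (psi : 'I_s -> W -> K).

(** The [h0 + h1] functions are independent on [O(A)] and lie in the span of the [2 * s] functions
    [two_copies psi]. *)
Lemma join_fam_card_le :
  (forall i, form m (b0 i)) -> (forall i, form m.+1 (b1 i)) ->
  free_on (O_group e) b0 -> free_on (O_group e) b1 ->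
  (forall f, form m.+1 f -> spanned_on SO_points psi f) ->
  (h0 + h1 <= 2 * s)%N.
Proof.
move=> hb0 hb1 free0 free1 span.
have := free_on_card_le (g := two_copies psi) (join_fam_free hb0 hb1 free0 free1).
rewrite card_sum card_prod card_bool !card_ord; apply.
have hW := form_graded W.
have lin1 : linear (fun w : W => w.1) by [].
case=> j /=.
  (* The last coordinate, equal to 1 at [(g, 1)], raises the degree from [m] to [m + 1]. *)
  have h2 : form 1 (fun w : W => w.2 : K) by exact: form_scalar.
  have := two_copies_spanned span (gradedM hW h2 (form_linear lin1 (hb0 j))).
  by case=> c hc; exists c => g Og; rewrite -hc // mul1r.
exact: (two_copies_spanned span (form_linear lin1 (hb1 j))).
Qed.

(** The [2 * s] independent functions have degree at most [d + n + 1 = m + 1] on [O(A)], so forms of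
    degrees [m] and [m + 1] span them. *)
Lemma two_copies_card_le d : m.+1 = (d + n.+1)%N ->
  (forall i, form d (psi i)) -> free_on SO_points psi ->
  (forall f, form m f -> spanned_on (O_group e) b0 f) ->
  (forall f, form m.+1 f -> spanned_on (O_group e) b1 f) ->
  (2 * s <= h0 + h1)%N.
Proof.
move=> md hpsi fpsi span0 span1.
have := free_on_card_le (g := join_fam b0 b1) (two_copies_free fpsi).
rewrite card_sum card_prod card_bool !card_ord; apply=> i.
apply: join_fam_spanned => //; rewrite md addnC.
exact: two_copies_affine_form.
Qed.

End Bases.
End DegreeComparison.

(** * Equality of the degrees *)

Lemma sum_shift_size_lead (P : {poly rat}) :
  size (P + (P \Po ('X + 1%:P))) = size P /\
  lead_coef (P + (P \Po ('X + 1%:P))) = 2%:R * lead_coef P.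
Proof.
have [->|P0] := eqVneq P 0.
  by rewrite comp_poly0 addr0 lead_coef0 mulr0.
(* The difference has smaller degree than [P], so [2 P] decides size and leading coefficient. *)
have -> : P + (P \Po ('X + 1%:P)) = 2%:R *: P + (P \Po ('X + 1%:P) - P).
  by rewrite scaler_nat mulr2n addrA addrAC addrK.
have s2 : size (2%:R *: P) = size P by rewrite size_scale // pnatr_eq0.
have lt : (size (P \Po ('X + 1%:P) - P)%R < size (2%:R *: P))%N.
  apply: leq_ltn_trans (size_shift_sub _ _) _.
  by rewrite s2 prednK // size_poly_gt0.
by rewrite size_polyDl // lead_coefDl // s2 lead_coefZ.
Qed.

Theorem proposition3p2 (K : closedFieldType) (charK0 : [pchar K]%R =i pred0)
    (n : nat) (n_ge1 : (1 <= n)%N)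
    (A : vectType K) (dimA : \dim (fullv : {vspace A}) = n.+1)
    (e : n.+1.-tuple A) (e_basis : basis_of fullv e) :
  exists d : nat,
    has_degree_PGL (PO_group e) d /\ has_degree_GL (SO_group e) d.
Proof.
have two_neq0 : 2%:R != 0 :> K by rewrite (pcharf0P K).1.
pose PO := zariski_closure (PO_group e).
pose SO := zariski_closure (affine_image (SO_group e)).
have [h [P [m0 [hP PE]]]] := hilbert_poly_exists PO.
have [s [Q [m1 [sQ QE]]]] := hilbert_poly_exists SO.
have O_neq0 g : O_group e g -> g != 0 by exact: O_group_neq0.
have SO_neq0 w : SO_points e w -> w != 0.
  by case=> g _ ->; rewrite -[0]/(0, 0) xpair_eqE oner_eq0 andbF.
have PO_E L : PO_group e L <-> exists2 g, O_group e g & val L = <[g]>%VS by [].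
have SO_E L : affine_image (SO_group e) L <->
    exists2 w, SO_points e w & val L = <[w]>%VS.
  split=> [[g Sg eL]|[_ [g Sg ->] eL]]; last by exists g.
  by exists (g, 1 : K^o) => //; exists g.
have basisO m := hilbert_value_basis O_neq0 PO_E (hP m).
have basisS m := hilbert_value_basis SO_neq0 SO_E (sQ m).
have le1 m : (h m + h m.+1 <= 2 * s m.+1)%N.
  have [b0 [fb0 free0 _]] := basisO m; have [b1 [fb1 free1 _]] := basisO m.+1.
  have [psi [_ _ span]] := basisS m.+1.
  exact: join_fam_card_le fb0 fb1 free0 free1 span.
have le2 m : (2 * s m.+1 <= h (m + n.+1)%N + h (m + n.+1).+1)%N.
  have [b0 [_ _ span0]] := basisO (m + n.+1)%N.
  have [b1 [_ _ span1]] := basisO (m + n.+1).+1.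
  have [psi [fpsi free _]] := basisS m.+1.
  exact: two_copies_card_le fpsi free span0 span1.
have [szPQ ldPQ] : size P = size Q /\ lead_coef P = lead_coef Q.
  have [szP ldP] := sum_shift_size_lead P.
  (* The inequalities place [2 s(m + 1)] between [h(m) + h(m + 1)] and its translate by [n + 1]. *)
  have [] := @sandwich_lead_coef (P + (P \Po ('X + 1%:P)))
    (2%:R *: (Q \Po ('X + 1%:P))) n.+1 (maxn m0 m1).
    move=> m; rewrite geq_max => /andP [hm0 hm1].
    rewrite !(hornerD, hornerZ) !horner_shift !natr1 !PE ?QE ?leqW //; last first.
    all: try by apply: leq_trans hm0 _; rewrite leq_addr.
    by rewrite -!natrD -natrM !ler_nat le1 le2.
  rewrite szP ldP size_scale ?pnatr_eq0 // lead_coefZ size_shift lead_coef_shift.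
  by move=> -> /mulfI ->; rewrite ?pnatr_eq0.
(* The values of [h] are natural numbers, so the common degree is an integer and nonnegative. *)
have [z hz] : exists z : int, (size P).-1`!%:R * lead_coef P = z%:~R.
  apply: (@integer_valued_lead_coef _ m0) => m /PE ->.
  by exists (h m).
have lP0 : 0 <= lead_coef P.
  by apply: (@ev_nonneg_lead_coef _ m0) => m /PE ->; apply: ler0n.
have : 0 <= z%:~R :> rat by rewrite -hz mulr_ge0.
rewrite ler0z; case: z hz => // d hd _; exists d; split.
  exists P; last by rewrite hd.
  by exists m0 => m hm; exists (h m); [exact: hP | exact: PE].
exists Q; last by rewrite -szPQ -ldPQ hd.
by exists m1 => m hm; exists (s m); [exact: sQ | exact: QE].
Qed.
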